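(* Let $x\in X$. Suppose the multifunction $\Phi_B:\mathrm{Gr}(\Phi_A)\to2^B$ is $A$-lower semicontinuous on $\mathrm{Gr}_{\mathrm{Gr}_{\{x\}}(\Phi_A)}(\Phi_B)$, the function $f^{A\leftrightarrow B}:\mathrm{Gr}(\Phi_B^{A\leftrightarrow B})\to\overline{\mathbb{R}}$ is $\mathbb{K}\mathbb{N}$-inf-compact on $\mathrm{Gr}_{\mathrm{Gr}_{\{x\}}(\Phi_A^{A\leftrightarrow B})}(\Phi_B^{A\leftrightarrow B})$, and the function $f:\mathrm{Gr}(\Phi_B)\to\overline{\mathbb{R}}$ is $B$-uniform feasible path transfer upper semicontinuous on $\mathrm{Gr}_{\mathrm{Gr}_{\{x\}}(\Phi_A)}(\Phi_B)$. Then the minimax function $f^*:X\to\overline{\mathbb{R}}$ is continuous at $x$, and moreover: (i) the infimum in $f^*(x)=\inf_{a\in\Phi_A(x)}f^{\#}(x,a)$ can be replaced with a minimum; (ii) if $f^*(x)<+\infty$, then $\Phi_A^*$ is upper semicontinuous at $x$, and $\Phi_A^*(x)$ is nonempty and compact.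
   Context: $X,A,B$ are topological spaces; $\Phi_A:X\to2^A$ and $\Phi_B:\mathrm{Gr}(\Phi_A)\to2^B$ are strict multifunctions (all values nonempty). For a multifunction $\Psi$ defined on a space $Z$ with values in subsets of $W$, $\mathrm{Gr}_E(\Psi)=\{(z,w):z\in E,\ w\in\Psi(z)\}$ for $E\subset Z$, and $\mathrm{Gr}(\Psi)=\mathrm{Gr}_Z(\Psi)$. $f:\mathrm{Gr}(\Phi_B)\subset X\times A\times B\to\overline{\mathbb{R}}=\mathbb{R}\cup\{\pm\infty\}$. Put $f^{\#}(x,a)=\sup_{b\in\Phi_B(x,a)}f(x,a,b)$ on $\mathrm{Gr}(\Phi_A)$, $f^*(x)=\inf_{a\in\Phi_A(x)}f^{\#}(x,a)$, and $\Phi_A^*(x)=\{a\in\Phi_A(x):f^*(x)=f^{\#}(x,a)\}$. A neighborhood of $x$ is an open subset of $X$ containing $x$. A multifunction $\Psi:X\to 2^A$ is upper semicontinuous at $x$ if for each open $V\supset\Psi(x)$ there is a neighborhood $U$ of $x$ with $\Psi(x')\subset V$ for $x'\in U$. Swapped objects: $\Phi_A^{A\leftrightarrow B}(x)=\{b\in B: b\in\Phi_B(x,a)\text{ for some }a\in\Phi_A(x)\}$; $\Phi_B^{A\leftrightarrow B}:\mathrm{Gr}(\Phi_A^{A\leftrightarrow B})\to2^A$, $\Phi_B^{A\leftrightarrow B}(x,b)=\{a\in\Phi_A(x):b\in\Phi_B(x,a)\}$; $f^{A\leftrightarrow B}(x,b,a)=f(x,a,b)$. $A$-lower semicontinuity: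 for $E\subset\mathrm{Gr}(\Phi_A)$, $\Phi_B$ is $A$-lower semicontinuous on $\mathrm{Gr}_E(\Phi_B)$ if for any $(x,a)\in E$, any $b\in\Phi_B(x,a)$ and any net $((x_\alpha,a_\alpha))_{\alpha\in I}$ in $\mathrm{Gr}(\Phi_A)$ with $x_\alpha\to x$ (the $a_\alpha$ need not converge) there exists a net $(b_\alpha)_{\alpha\in I}$ with $b_\alpha\in\Phi_B(x_\alpha,a_\alpha)$ for each $\alpha$ such that $b$ is a limit point (accumulation point) of $(b_\alpha)$. $B$-uniform feasible path transfer upper semicontinuity: for $E\subset\mathrm{Gr}(\Phi_A)$, $f$ has this property on $\mathrm{Gr}_E(\Phi_B)$ if, for each $(x,a)\in E$ and $\lambda\in\mathbb{R}$, whenever there is $\varepsilon>0$ with $f(x,a,b)+\varepsilon<\lambda$ for each $b\in\Phi_B(x,a)$, there are $\varepsilon'>0$ and a neighborhood $U$ of $x$ such that for each $x'\in U$ there exists $a'\in\Phi_A(x')$ such that $f(x',a',b')+\varepsilon'<\lambda$ for each $b'\in\Phi_B(x',a')$. $\mathbb{K}\mathbb{N}$-inf-compactness: for a multifunction $\Psi:Z\to2^W$, $v:\mathrm{Gr}(\Psi)\to\overline{\mathbb{R}}$ and $E\subset\{z\in Z:\Psi(z)\ne\emptyset\}$, $v$ is $\mathbb{K}\mathbb{N}$-inf-compact on $\mathrm{Gr}_E(\Psi)$ if (1) $v$ is lower semicontinuous, as a function on $\mathrm{Gr}(\Psi)$, at each point of $\mathrm{Gr}_E(\Psi)$; and (2)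 if a net $(z_\alpha)$ in $\{z\in Z:\Psi(z)\neq\emptyset\}$ converges to $z\in E$, then each net $(w_\alpha)$ with $w_\alpha\in\Psi(z_\alpha)$ such that $\{v(z_\alpha,w_\alpha)\}$ is bounded above has an accumulation point $w\in\Psi(z)$. Here it is applied with $Z=\mathrm{Gr}(\Phi_A^{A\leftrightarrow B})\subset X\times B$, $W=A$, $\Psi=\Phi_B^{A\leftrightarrow B}$, $v=f^{A\leftrightarrow B}$. *)

(* Defs.v *)
From HB Require Import structures.
From mathcomp Require Import all_boot all_order all_algebra.
From mathcomp Require Import all_classical all_reals.
From mathcomp Require Import topology ereal normedtype.

Set Implicit Arguments.
Unset Strict Implicit.
Unset Printing Implicit Defensive.

Import Order.TTheory GRing.Theory Num.Theory.

Local Open Scope classical_set_scope.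
Local Open Scope ring_scope.
Local Open Scope ereal_scope.

(* A multifunction or function whose domain is a subset of a space is
   represented by a total one, used below only at points of that domain.
   Thus Phi_B is total on X * A and f on X * A * B, but Phi_B is evaluated only
   on the graph of Phi_A and f only on the graph of Phi_B. *)

Section Nets.

Record directed (I : Type) (le : I -> I -> Prop) : Prop := Directed {
  directed_inhabited : exists i : I, True;
  directed_refl : forall i, le i i;
  directed_trans : forall i j k, le i j -> le j k -> le i k;
  directed_ub : forall i j, exists2 k, le i k & le j k }.

(* A net is a map u out of a directed (I, le): its limits are the l such that
   u @ tails le --> l, its accumulation points are cluster (u @ tails le). *)
Definition tails (I : Type) (le : I -> I -> Prop) : set_system I :=
  [set S | exists i, forall j, le i j -> S j].

End Nets.

Section Multifunctions.
Context {Z W : topologicalType}.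

Definition gr (E : set Z) (Psi : Z -> set W) : set (Z * W) :=
  [set p | E p.1 /\ Psi p.1 p.2].

Definition strict_on (D : set Z) (Psi : Z -> set W) : Prop :=
  forall z, D z -> Psi z !=set0.

Definition usc_multifunction_at (Psi : Z -> set W) (z : Z) : Prop :=
  forall V : set W, open V -> Psi z `<=` V ->
    exists2 U : set Z, open_nbhs z U & forall z', U z' -> Psi z' `<=` V.

End Multifunctions.

Section InfCompactness.
Context {R : realType}.

(* Localization of lower_semicontinuous to a point p, for a function on the
   subspace D. *)
Definition lower_semicontinuous_at (T : topologicalType) (D : set T)
    (v : T -> \bar R) (p : T) : Prop :=
  forall r : R, r%:E < v p -> \forall q \near within D (nbhs p), r%:E < v q.

(* D is the domain of Psi. *)
Definition KN_inf_compact (Z W : topologicalType) (D : set Z)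
    (Psi : Z -> set W) (v : Z * W -> \bar R) (E : set Z) : Prop :=
  (forall p, gr E Psi p -> lower_semicontinuous_at (gr D Psi) v p) /\
  (forall (I : Type) (le : I -> I -> Prop) (z_ : I -> Z) (z : Z),
     directed le ->
     (forall i, D (z_ i) /\ Psi (z_ i) !=set0) ->
     E z -> z_ @ tails le --> z ->
     forall w_ : I -> W,
       (forall i, Psi (z_ i) (w_ i)) ->
       (exists M : R, forall i, v (z_ i, w_ i) <= M%:E) ->
       exists2 w, Psi z w & cluster (w_ @ tails le) w).

End InfCompactness.

Section Minimax.
Context {R : realType} {X A B : topologicalType}.
Variables (PhiA : X -> set A) (PhiB : X * A -> set B) (f : X * A * B -> \bar R).

Definition fsharp (xa : X * A) : \bar R :=
  ereal_sup [set f (xa, b) | b in PhiB xa].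

Definition fstar (x : X) : \bar R :=
  ereal_inf [set fsharp (x, a) | a in PhiA x].

Definition PhiAstar (x : X) : set A :=
  [set a | PhiA x a /\ fstar x = fsharp (x, a)].

Definition PhiA_swap (x : X) : set B :=
  [set b | exists2 a, PhiA x a & PhiB (x, a) b].

Definition PhiB_swap (xb : X * B) : set A :=
  [set a | PhiA xb.1 a /\ PhiB (xb.1, a) xb.2].

Definition f_swap (xba : X * B * A) : \bar R := f (xba.1.1, xba.2, xba.1.2).

Definition A_lower_semicontinuous (E : set (X * A)) : Prop :=
  forall (x : X) (a : A) (b : B), E (x, a) -> PhiB (x, a) b ->
  forall (I : Type) (le : I -> I -> Prop) (x_ : I -> X) (a_ : I -> A),
    directed le ->
    (forall i, gr setT PhiA (x_ i, a_ i)) ->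
    x_ @ tails le --> x ->
    exists2 b_ : I -> B,
      forall i, PhiB (x_ i, a_ i) (b_ i) & cluster (b_ @ tails le) b.

Definition B_uniform_fpt_usc (E : set (X * A)) : Prop :=
  forall (x : X) (a : A) (lambda : R), E (x, a) ->
  (exists2 eps : R, (0 < eps)%R &
     forall b, PhiB (x, a) b -> f (x, a, b) + eps%:E < lambda%:E) ->
  exists2 eps' : R, (0 < eps')%R &
  exists2 U : set X, open_nbhs x U &
  forall x', U x' -> exists2 a', PhiA x' a' &
    forall b', PhiB (x', a') b' -> f (x', a', b') + eps'%:E < lambda%:E.

End Minimax.

(* Main.v *)
Require Import Defs.
From mathcomp Require Import all_boot all_order all_algebra.
From mathcomp Require Import all_classical all_reals.
From mathcomp Require Import topology ereal normedtype.

Import Order.TTheory GRing.Theory Num.Theory.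
Import numFieldNormedType.Exports.

Local Open Scope classical_set_scope.
Local Open Scope ring_scope.
Local Open Scope ereal_scope.

(** Everything happens at the one point [x], and follows from two facts about
    [g = fsharp PhiB f].

    (1) [g] inherits the inf-compactness of the swapped function
    ([fsharp_inf_compact_at]). Let [(x', a')] move along a filter with
    [x' --> x] and with [g (x', a')] bounded above. Fix any [b0] feasible at
    [x]. Lower semicontinuity of [PhiB] gives feasible [b'] arbitrarily near
    [b0], and [f (x', a', b') <= g (x', a')] stays bounded; so the
    inf-compactness of [f_swap f] at [(x, b0)] makes the [a'] cluster at some
    [a] in [PhiA x]. Moreover [g (x, a)] is at most any eventual bound [r] of
    [g (x', a')]: if [f (x, a, b) > r] for some feasible [b], then lower
    semicontinuity of [f] at [(x, a, b)] and of [PhiB] at [b] would give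
    [f (x', a', b') > r] for some [(x', a', b')] with [g (x', a') <= r]. The
    lower semicontinuity of [PhiB] has to hold for arbitrary [a'], because
    the [a'] are not known to converge when it is first used.

    (2) The infimum [fstar] is upper semicontinuous at [x] ([fstar_usc]): path
    transfer turns an [a] with [g (x, a) < r] into an [a'] with
    [g (x', a') < r] for each [x'] near [x].

    The conclusions are then those of a parametric minimization of [g] over
    [PhiA], and each comes from applying (1) to a suitable filter: if [fstar]
    were not lower semicontinuous, points over [x' --> x] with
    [g <= s < fstar x] would give an [a] with [g (x, a) <= s], which is absurd;
    minimizing sequences over [x] give a minimizer; filters on [PhiAstar x]
    give its compactness; minimizers over [x' --> x] that lie outside an open
    [V] containing [PhiAstar x] would, with (2), cluster at a point of
    [PhiAstar x].

    Arguing with filters instead of nets avoids subnets. The hypotheses, which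
    speak of nets, are moved to filters once and for all by presenting every
    proper filter as the filter of tails of a net ([filter_as_tails]). *)

(** * Filters and nets *)

(** The net is indexed by the pointed members [(p, S)] of [F] with [p] in [S],
    ordered by reverse inclusion of [S], and takes the value [p] there.
    Keeping only the [S] included in [S0] makes all its values, rather than
    eventually all, lie in [S0]: this is what hypotheses on every term of a net
    require. *)
Lemma filter_as_tails {T : Type} (F : set_system T) (S0 : set T) :
  ProperFilter F -> F S0 ->
  exists (I : Type) (le : I -> I -> Prop) (t_ : I -> T),
    [/\ directed le, forall i, S0 (t_ i) & t_ @ tails le = F].
Proof.
move=> PF FS0.
pose I := {pS : T * set T | [/\ F pS.2, pS.2 `<=` S0 & pS.2 pS.1]}.
pose le (i j : I) := (sval j).2 `<=` (sval i).2.
have mkI S : F S -> S `<=` S0 -> forall p, S p ->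
    {i : I | sval i = (p, S)}.
  by move=> FS SS0 p Sp; exists (exist _ (p, S) (And3 FS SS0 Sp)).
exists I, le, (fun i => (sval i).1); split.
- split.
  + have [p S0p] := filter_ex FS0.
    by have [i _] := mkI _ FS0 (@subset_refl _ _) p S0p; exists i.
  + by move=> i; exact: subset_refl.
  + by move=> i j k ij jk; exact: subset_trans jk ij.
  + move=> [[p S] pS] [[q S'] qS']; have [FS SS0 _] := pS.
    have [FS' _ _] := qS'; have FI : F (S `&` S') by exact: filterI.
    have [r Ir] := filter_ex FI.
    have [k kE] := mkI _ FI (subset_trans (@subIsetl _ _ _) SS0) r Ir.
    by exists k; rewrite /le kE => y [].
- by move=> [[p S] pS] /=; have [_ SS0 Sp] := pS; exact: SS0.
- rewrite predeqE => P; split.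
  + move=> [[[p S] pS]] tP; have [FS SS0 _] := pS.
    apply: (filterS _ FS) => q Sq.
    have [j jE] := mkI _ FS SS0 q Sq.
    by have := tP j; rewrite /le /= jE; apply.
  + move=> FP.
    have FI : F (P `&` S0) by exact: filterI.
    have [p Ip] := filter_ex FI.
    have [i iE] := mkI _ FI (@subIsetr _ _ _) p Ip.
    exists i => -[[q S] qS]; rewrite /le iE /= => SI; have [_ _ Sq] := qS.
    by have [] := SI q Sq.
Qed.

(** The filter generated by the traces on [P] of the preimages of [N]. It turns
    the failure of a property near a point into a filter of counterexamples
    converging to that point. *)
Lemma filter_of_approach {X T : Type} (N : set_system X) (h : T -> X)
    (P : set T) : Filter N ->
  (forall U, N U -> exists2 p, U (h p) & P p) ->
  exists F : set_system T,
    [/\ ProperFilter F, F P & h @ F --> N].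
Proof.
move=> FN NP.
exists (filter_from N (fun U => [set p | U (h p) /\ P p])); split.
- apply: filter_from_proper => [|U /NP[p Up Pp]]; last by exists p.
  apply: filter_from_filter; first by exists setT; exact: filterT.
  move=> U V NU NV; exists (U `&` V); first exact: filterI.
  by move=> p [[Up Vp] Pp].
- by exists setT => [|p []//]; exact: filterT.
- by move=> U NU; exists U => // p [].
Qed.

(** * Extended reals *)

Section Ereal.
Context {R : realType}.

Lemma ereal_between (u v : \bar R) :
  u < v -> exists2 r : R, u < r%:E & r%:E < v.
Proof.
case: u v => [u| |] [v| |] //=.
- rewrite lte_fin => uv; exists ((u + v) / 2)%R; rewrite lte_fin.
  + by rewrite midf_lt.
  + by rewrite midf_lt.
- by move=> _; exists (u + 1)%R; rewrite ?ltry // lte_fin ltrDl.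
- by move=> _; exists (v - 1)%R; rewrite ?ltNyr // lte_fin ltrBlDr ltrDl.
- by move=> _; exists 0%R; rewrite ?ltNyr ?ltry.
Qed.

Lemma lee_real_ub (u v : \bar R) :
  (forall r : R, v < r%:E -> u <= r%:E) -> u <= v.
Proof.
move=> uv; rewrite leNgt; apply/negP => /ereal_between[r vr ru].
by have := uv r vr; rewrite leNgt ru.
Qed.

Lemma continuous_at_semicontinuous {X : topologicalType} (h : X -> \bar R)
    (x : X) :
  (forall r : R, r%:E < h x -> \forall y \near x, r%:E < h y) ->
  (forall r : R, h x < r%:E -> \forall y \near x, h y < r%:E) ->
  continuous_at x h.
Proof.
move=> lsc usc S; change (ereal_nbhs (h x) S -> nbhs x (h @^-1` S)).
case hx : (h x) lsc usc => [s| |] lsc usc /=.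
- move=> /nbhs_ballP[e /= e0 eS].
  have l : (s - e)%:E < s%:E by rewrite lte_fin ltrBlDr ltrDl.
  have u : s%:E < (s + e)%:E by rewrite lte_fin ltrDl.
  apply: filterS2 (lsc _ l) (usc _ u) => y /=.
  case: (h y) => [t| |] //; rewrite !lte_fin => lt ut /=.
  by apply: (eS t); rewrite /ball /= ltr_distlC lt ut.
- by move=> [M [_ MS]]; apply: filterS (lsc M (ltry M)) => y; exact: MS.
- by move=> [M [_ MS]]; apply: filterS (usc M (ltNyr M)) => y; exact: MS.
Qed.

End Ereal.

(** * Minimization of an inf-compact function *)

Section InfCompactAt.
Context {R : realType} {X A : topologicalType}.
Variables (Phi : X -> set A) (g : X * A -> \bar R).

(** Inf-compactness at [x] in filter form, with the accumulation point and the
    semicontinuity estimate merged: the same [a] serves for every eventual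
    bound [r], so that [g (x, a)] is at most the upper limit of [g] along
    [F]. *)
Definition inf_compact_at (x : X) : Prop :=
  forall F : set_system (X * A), ProperFilter F ->
    fst @ F --> x -> F (gr setT Phi) ->
    (exists M : R, F [set p | g p <= M%:E]) ->
    exists a, [/\ Phi x a, cluster (snd @ F) a &
      forall r : R, F [set p | g p <= r%:E] -> g (x, a) <= r%:E].

Definition inf_value (x : X) : \bar R := ereal_inf [set g (x, a) | a in Phi x].

Definition argmin (x : X) : set A :=
  [set a | Phi x a /\ inf_value x = g (x, a)].

Lemma inf_value_le (x : X) (a : A) : Phi x a -> inf_value x <= g (x, a).
Proof. by move=> Pa; apply: ereal_inf_lbound; exists a. Qed.

Lemma inf_value_lt (x : X) (u : \bar R) :
  inf_value x < u -> exists2 a, Phi x a & g (x, a) < u.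
Proof. by move=> /ereal_inf_lt[_ [a Pa <-] au]; exists a. Qed.

Variable x : X.
Hypothesis g_inf_compact : inf_compact_at x.

Lemma inf_compact_at_lsc (r : R) :
  r%:E < inf_value x -> \forall y \near x, r%:E < inf_value y.
Proof.
move=> /ereal_between[s]; rewrite lte_fin => rs sx; apply: contrapT => nlsc.
pose P := gr setT Phi `&` [set p | g p <= s%:E].
have [|F [PF FP Fx]] := @filter_of_approach _ _ (nbhs x) fst P _.
  move=> U xU; apply: contrapT => nP; apply: nlsc.
  apply: filterS xU => y Uy; rewrite ltNge; apply/negP => yr.
  have [|a Pa gs] := inf_value_lt y s%:E.
    by rewrite (le_lt_trans yr) ?lte_fin.
  by apply: nP; exists (y, a) => //; split=> //; exact: ltW.
have Fs : F [set p | g p <= s%:E] by apply: filterS FP => p [].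
have [||a [Pa _ gle]] := g_inf_compact F _ Fx.
- by apply: filterS FP => p [].
- by exists s.
have := inf_value_le _ _ Pa; rewrite leNgt => /negP; apply.
by apply: le_lt_trans sx; exact: gle.
Qed.

(** The sublevel sets of [g] over [x], at all levels above the infimum, generate
    the filter of minimizing sequences; its cluster point is a minimizer. *)
Lemma inf_compact_at_min : Phi x !=set0 -> argmin x !=set0.
Proof.
move=> [a0 Pa0]; case: (ltP (inf_value x) +oo) => [lty|]; last first.
  (* No real level lies above +oo, but every feasible point attains it. *)
  rewrite leye_eq => /eqP gy; exists a0; split=> //.
  by have := inf_value_le _ _ Pa0; rewrite gy leye_eq => /eqP.
have [F [PF FP Fr]] : exists F : set_system (X * A),
    [/\ ProperFilter F, F [set p | p.1 = x /\ Phi x p.2] &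
      forall r : R, inf_value x < r%:E -> F [set p | g p <= r%:E]].
  pose B (r : R) := [set p | [/\ p.1 = x, Phi x p.2 & g p <= r%:E]].
  have [M xM _] := ereal_between _ _ lty.
  exists (filter_from [set r | inf_value x < r%:E] B); split.
  - apply: filter_from_proper => [|r /inf_value_lt[a Pa /ltW ar]]; last first.
      by exists (x, a).
    apply: filter_from_filter; first by exists M.
    move=> r s xr xs; exists (Order.min r s).
      by rewrite /=; case: (leP r s).
    move=> p [p1 p2]; rewrite EFin_min le_min => /andP[pr ps].
    by split; split.
  - by exists M => // p [].
  - by move=> r xr; exists r => // p [].
have Fx : fst @ F --> x.
  move=> U xU; apply: (@filterS _ F _ _ _ _ FP) => p /= [-> _].
  exact: nbhs_singleton.
have [||a [Pa _ gle]] := g_inf_compact F PF Fx.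
- by apply: filterS FP => -[y a] /= [-> Pa]; split.
- by have [M xM _] := ereal_between _ _ lty; exists M; exact: Fr.
exists a; split=> //; apply/eqP; rewrite eq_le inf_value_le //=.
by apply: lee_real_ub => r xr; exact/gle/Fr.
Qed.

(** The hypothesis on [inf_value p.1] is the upper semicontinuity of [inf_value]
    along [F]. It is left as a hypothesis on [F] because it is trivial for
    filters over the fixed point [x], as in the proof of compactness. *)
Lemma inf_compact_at_argmin_cluster (F : set_system (X * A)) :
  inf_value x < +oo -> ProperFilter F -> fst @ F --> x ->
  F (gr setT argmin) ->
  (forall r : R, inf_value x < r%:E -> F [set p | inf_value p.1 < r%:E]) ->
  exists2 a, argmin x a & cluster (snd @ F) a.
Proof.
move=> lty PF Fx Fargmin Flt.
have Fg r : inf_value x < r%:E -> F [set p | g p <= r%:E].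
  move=> /Flt; apply: filterS2 Fargmin => -[y a] /= [_ [_ ->]]; exact: ltW.
have [||a [Pa aF gle]] := g_inf_compact F PF Fx.
- by apply: filterS Fargmin => -[y a] [_ []].
- by have [M xM _] := ereal_between _ _ lty; exists M; exact: Fg.
exists a => //; split=> //; apply/eqP; rewrite eq_le inf_value_le //=.
by apply: lee_real_ub => r xr; exact/gle/Fg.
Qed.

Lemma inf_compact_at_argmin_compact : inf_value x < +oo -> compact (argmin x).
Proof.
move=> lty F PF Fargmin.
have Fx : fst @ (pair x @ F) --> x.
  by move=> U xU; apply: (@filterE _ F) => a; exact: nbhs_singleton xU.
have [||a aarg aF] := inf_compact_at_argmin_cluster _ lty _ Fx.
- by apply: (@filterS _ F _ _ _ _ Fargmin) => a; split.
- by move=> r xr; apply: (@filterE _ F).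
by exists a.
Qed.

Lemma inf_compact_at_argmin_usc : inf_value x < +oo ->
  (forall r : R, inf_value x < r%:E -> \forall y \near x, inf_value y < r%:E) ->
  usc_multifunction_at argmin x.
Proof.
move=> lty usc V oV xV; apply: contrapT => nU.
pose P := gr setT argmin `&` [set p | ~ V p.2].
have [|F [PF FP Fx]] := @filter_of_approach _ _ (nbhs x) fst P _.
  rewrite /= => U; rewrite nbhsE => -[W xW WU]; apply: contrapT => nP.
  apply: nU; exists W => // y Wy a ya; apply: contrapT => nVa.
  by apply: nP; exists (y, a); [exact: WU|split].
have [||a aarg aF] := @inf_compact_at_argmin_cluster F lty PF Fx.
- by apply: filterS FP => p [].
- by move=> r /usc /Fx.
have aV : nbhs a V by apply: open_nbhs_nbhs; split=> //; exact: xV.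
have FnV : (snd @ F) (~` V) by apply: (@filterS _ F _ _ _ _ FP) => p [].
by have [a' [nVa']] := aF _ _ FnV aV.
Qed.

End InfCompactAt.

(** * Inf-compactness of the inner supremum *)

Lemma KN_inf_compact_filter {R : realType} {Z W : topologicalType}
    (D : set Z) (Psi : Z -> set W) (v : Z * W -> \bar R) (E : set Z) (z : Z)
    (F : set_system (Z * W)) (M : R) :
  KN_inf_compact D Psi v E -> E z -> ProperFilter F -> fst @ F --> z ->
  F (gr D Psi) -> F [set p | v p <= M%:E] ->
  exists2 w, Psi z w & cluster (snd @ F) w.
Proof.
move=> [_ KN] Ez PF Fz FPsi FM.
have [I [le [t_ [dle tP tF]]]] := filter_as_tails F _ PF (filterI FPsi FM).
rewrite -tF.
apply: (KN I le (fst \o t_) z dle _ Ez _ (snd \o t_)).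
- by move=> i; have [[Dt Pt] _] := tP i; split=> //; exists (t_ i).2.
- by move: Fz; rewrite -tF.
- by move=> i; have [[]] := tP i.
- by exists M => i; have [_] := tP i; rewrite /= -surjective_pairing.
Qed.

Section Minimax.
Context {R : realType} {X A B : topologicalType}.
Variables (PhiA : X -> set A) (PhiB : X * A -> set B) (f : X * A * B -> \bar R).

(** Otherwise points [(y, a')] with [PhiB (y, a')] disjoint from [V] would occur
    for [y] arbitrarily near [x], and along a net of these no selection of
    [PhiB] could accumulate at [b]. *)
Lemma A_lower_semicontinuous_near (E : set (X * A)) (x : X) (a : A) (b : B)
    (V : set B) :
  A_lower_semicontinuous PhiA PhiB E -> E (x, a) -> PhiB (x, a) b ->
  nbhs b V ->
  \forall y \near x, forall a', PhiA y a' -> PhiB (y, a') `&` V !=set0.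
Proof.
move=> Alsc Exa ab bV; apply: contrapT => nnear.
pose P := gr setT PhiA `&` [set p | ~ (PhiB p `&` V !=set0)].
have [|F [PF FP Fx]] := @filter_of_approach _ _ (nbhs x) fst P _.
  move=> U xU; apply: contrapT => nP; apply: nnear.
  apply: filterS xU => y Uy a' ya'; apply: contrapT => nV.
  by apply: nP; exists (y, a').
have [I [le [t_ [dle tP tF]]]] := filter_as_tails F _ PF FP.
have tA i : gr setT PhiA ((t_ i).1, (t_ i).2).
  by rewrite -surjective_pairing; have [] := tP i.
have tx : (fst \o t_) @ tails le --> x by move: Fx; rewrite -tF.
have [b_ b_P bcl] := Alsc x a b Exa ab I le _ _ dle tA tx.
have [|_ [[i _ <-] Vi]] := bcl (range b_) V _ bV.
  by have [[i _] _ _ _] := dle; exists i => j _; exists j.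
have [_] := tP i; apply; exists (b_ i); split=> //.
by have := b_P i; rewrite /= -surjective_pairing.
Qed.

Lemma fsharp_inf_compact_at (x : X) :
  strict_on setT PhiA -> strict_on (gr setT PhiA) PhiB ->
  A_lower_semicontinuous PhiA PhiB (gr [set x] PhiA) ->
  KN_inf_compact (gr setT (PhiA_swap PhiA PhiB)) (PhiB_swap PhiA PhiB)
    (f_swap f) (gr [set x] (PhiA_swap PhiA PhiB)) ->
  inf_compact_at PhiA (fsharp PhiB f) x.
Proof.
move=> sA sB Alsc KN F PF Fx FA [M FM].
have [a0 xa0] := sA x I.
have [b0 ab0] := sB (x, a0) (conj I xa0).
(* The filter G carries feasible triples (x', b', a') for which (x', a') follows
   F and b' tends to b0; near-b0 feasibility makes it proper. *)
pose P := [set p : X * B * A | PhiB (p.1.1, p.2) p.1.2].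
have [|G [PG GP GF]] := @filter_of_approach _ _
    (filter_prod F (nbhs b0)) (fun p : X * B * A => (p.1.1, p.2, p.1.2)) P _.
  move=> U [[S V] [/= FS b0V] SVU].
  have near :=
    A_lower_semicontinuous_near _ _ _ _ _ Alsc (conj erefl xa0) ab0 b0V.
  have Fnear := Fx _ near : F (fst @^-1` _).
  have [[y a] [/= [Sp [_ ya]] yV]] := filter_ex (filterI (filterI FS FA) Fnear).
  have [b [yb Vb]] := yV _ ya.
  by exists (y, b, a) => //; apply: SVU.
have GF' S : F S -> G [set p | S (p.1.1, p.2)].
  move=> FS; apply: (GF [set q | S q.1]); exists (S, setT) => /=.
    by split=> //; exact: filterT.
  by move=> q [].
have Gb : (fun p : X * B * A => p.1.2) @ G --> b0.
  move=> V b0V; apply: (GF [set q | V q.2]); exists (setT, V) => /=.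
    by split=> //; exact: filterT.
  by move=> q [].
have Gz : fst @ G --> (x, b0).
  move=> S [[U V] [/= xU bV] UVS].
  have FU := Fx _ xU : F (fst @^-1` U).
  have GV := Gb _ bV : G (_ @^-1` V).
  apply: (@filterS _ G _ _ _ _ (filterI (GF' _ FU) GV)).
  by move=> -[[y b] a] [/= Uy Vb]; exact: UVS.
have [|||a /= [xa ab] aG] := KN_inf_compact_filter _ _ _ _ _ G M KN _ PG Gz.
- by split=> //; exists a0.
- apply: filterS2 GP (GF' _ FA) => -[[y b] a] /= yb [_ ya].
  by split=> //; split=> //; exists a.
- apply: filterS2 GP (GF' _ FM) => -[[y b] a] /= yb; apply: le_trans.
  by apply: ereal_sup_ubound; exists b.
have aF : cluster (snd @ F) a.
  by apply: cvg_cluster aG => S FS; exact: (GF' [set p | S p.2]).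
exists a; split=> // r Fr; apply: ge_ereal_sup => _ [b yb <-].
rewrite leNgt; apply/negP => rf.
(* Lower semicontinuity of f at (x, a, b) makes f > r on the feasible points of
   U * V * W, while F meets U * W at points where PhiB reaches V and
   fsharp <= r. *)
have [[S W] [/= [[U V] [/= xU bV] UVS] aW] SWf] :=
  KN.1 (x, b, a) (conj (conj erefl (ex_intro2 _ _ a xa yb)) (conj xa yb)) r rf.
have near := A_lower_semicontinuous_near _ _ _ _ _ Alsc (conj erefl xa) yb bV.
pose S' := [set p : X * A | [/\ U p.1, gr setT PhiA p, fsharp PhiB f p <= r%:E &
  forall a', PhiA p.1 a' -> PhiB (p.1, a') `&` V !=set0]].
have FS' : F S'.
  have FU := Fx _ xU : F (fst @^-1` _).
  have FV := Fx _ near : F (fst @^-1` _).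
  apply: (@filterS _ F _ _ _ _ (filterI (filterI (filterI FU FV) FA) Fr)).
  by move=> p [[[Up pV] pA] pr]; split.
have [|a' [[[y c] [/= Uy [_ ya'] yr yV] <-] Wc]] := aF (snd @` S') W _ aW.
  by apply: (@filterS _ F _ _ _ _ FS') => p Sp; exists p.
have [d [yd Vd]] := yV _ ya'.
have : r%:E < f (y, c, d).
  apply: (SWf (y, d, c)); first by split=> //=; exact: UVS.
  by split=> //; split=> //; exists c.
rewrite ltNge => /negP; apply; apply: le_trans yr.
by apply: ereal_sup_ubound; exists d.
Qed.

(** * Upper semicontinuity of the minimax value *)

Lemma fstar_usc (x : X) :
  B_uniform_fpt_usc PhiA PhiB f (gr [set x] PhiA) ->
  forall r : R, fstar PhiA PhiB f x < r%:E ->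
    \forall y \near x, fstar PhiA PhiB f y < r%:E.
Proof.
move=> fpt r /ereal_between[s xs]; rewrite lte_fin => sr.
(* The level s strictly between fstar x and r supplies the uniform gap r - s. *)
have [_ [a xa <-] as_] := ereal_inf_lt xs.
have [|e e0 [U [oU Ux] Ue]] := fpt x a r (conj erefl xa).
  exists (r - s)%R; first by rewrite subr_gt0.
  move=> b ab; have fs : f (x, a, b) < s%:E.
    by apply: le_lt_trans as_; apply: ereal_sup_ubound; exists b.
  by rewrite -lteBrDr// -EFinB subKr.
have xU : nbhs x U by exact: open_nbhs_nbhs.
apply: filterS xU => y /Ue[a' ya' fe].
apply: (@le_lt_trans _ _ (r - e)%:E); last by rewrite lte_fin ltrBlDr ltrDl.
apply: (@le_trans _ _ (fsharp PhiB f (y, a'))).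
  by apply: ereal_inf_lbound; exists a'.
apply: ge_ereal_sup => _ [b yb <-].
by apply: ltW; rewrite EFinB lteBrDr// fe.
Qed.

End Minimax.

(** * Continuity of the minimax value and of its solutions *)

Theorem theorem19 (R : realType) (X A B : topologicalType)
    (PhiA : X -> set A) (PhiB : X * A -> set B) (f : X * A * B -> \bar R)
    (PhiA_strict : strict_on setT PhiA)
    (PhiB_strict : strict_on (gr setT PhiA) PhiB)
    (x : X)
    (PhiB_Alsc : A_lower_semicontinuous PhiA PhiB (gr [set x] PhiA))
    (f_swap_KN : KN_inf_compact
       (gr setT (PhiA_swap PhiA PhiB)) (PhiB_swap PhiA PhiB) (f_swap f)
       (gr [set x] (PhiA_swap PhiA PhiB)))
    (f_fpt : B_uniform_fpt_usc PhiA PhiB f (gr [set x] PhiA)) :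
  continuous_at x (fstar PhiA PhiB f) /\
  (exists2 a, PhiA x a & fstar PhiA PhiB f x = fsharp PhiB f (x, a)) /\
  (fstar PhiA PhiB f x < +oo ->
     usc_multifunction_at (PhiAstar PhiA PhiB f) x /\
     PhiAstar PhiA PhiB f x !=set0 /\
     compact (PhiAstar PhiA PhiB f x)).
Proof.
have gK : inf_compact_at PhiA (fsharp PhiB f) x.
  exact: fsharp_inf_compact_at.
have usc := fstar_usc _ _ _ _ f_fpt.
have [a [xa fa]] := inf_compact_at_min _ _ _ gK (PhiA_strict x I).
split.
  exact: continuous_at_semicontinuous (inf_compact_at_lsc _ _ _ gK) usc.
split; first by exists a.
move=> lty; split; first exact: inf_compact_at_argmin_usc.
split; first by exists a.
exact: inf_compact_at_argmin_compact.
Qed.
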